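(* Let $\alpha,\beta$ be positive reals, let $x$ be a number with $x^2-4x\neq 0$, and set $\lambda=\frac12\left(x-2+\sqrt{x^2-4x}\right)$ and $\kappa=\frac12\left(x-2-\sqrt{x^2-4x}\right)$. Then for every nonnegative integer $m$, \[\overline{G}^{\alpha,\beta}_{2m}(x)=\frac{\lambda^m[(\kappa+1)\alpha-x\beta]-\kappa^m[(\lambda+1)\alpha-x\beta]}{\kappa-\lambda},\qquad \overline{G}^{\alpha,\beta}_{2m+1}(x)=\frac{\lambda^m[\alpha-(\lambda+1)\beta]-\kappa^m[\alpha-(\kappa+1)\beta]}{\kappa-\lambda}.\]
   Context: For positive reals $\alpha,\beta$, the sign-alternating Gibonacci polynomials are defined by $\overline{G}^{\alpha,\beta}_0(x)=\alpha$, $\overline{G}^{\alpha,\beta}_1(x)=\beta$, and $\overline{G}^{\alpha,\beta}_k(x)=x^{(k-1)\bmod 2}\,\overline{G}^{\alpha,\beta}_{k-1}(x)-\overline{G}^{\alpha,\beta}_{k-2}(x)$ for $k\ge2$ (equivalently, their coefficients are the signed rows of the array $g_{0,0}=\alpha$, $g_{1,0}=\beta$, $g_{k,j}=g_{k-1,j}+g_{k-2,j-1}$, via $\overline{G}^{\alpha,\beta}_k(x)=\sum_{j=0}^{\lfloor k/2\rfloor}(-1)^jg_{k,j}x^{\lfloor k/2\rfloor-j}$). Here $\lambda,\kappa$ are the two roots of $t^2-(x-2)t+1$ (so $\lambda\kappa=1$, $\lambda+\kappa=x-2$); the formulas do not depend on which square root is chosen. *)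

(* Defs.v *)
From mathcomp Require Import all_boot all_order all_algebra.
From mathcomp Require Import reals complex.

Set Implicit Arguments.
Unset Strict Implicit.
Unset Printing Implicit Defensive.

Import GRing.Theory.
Local Open Scope ring_scope.

(* At index k = k2.+2 the exponent of 'X is (k - 1) %% 2 = k1 %% 2. *)
Fixpoint sgibonacci (R : realType) (alpha beta : R) (k : nat) : {poly R} :=
  match k with
  | 0 => alpha%:P
  | k1.+1 =>
    match k1 with
    | 0 => beta%:P
    | k2.+1 => 'X^(k1 %% 2) * sgibonacci alpha beta k1 - sgibonacci alpha beta k2
    end
  end.

Definition sgibonacci_at (R : realType) (alpha beta : R) (k : nat) (x : R[i]) :
    R[i] :=
  (map_poly (real_complex R) (sgibonacci alpha beta k)).[x].

(* Main.v *)
Require Import Defs.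
From mathcomp Require Import all_boot all_order all_algebra.
From mathcomp Require Import reals complex.
From mathcomp Require Import ring.

Import GRing.Theory.

Local Open Scope ring_scope.
Local Open Scope complex_scope.

(** Evaluated at [x], the even- and odd-indexed polynomials satisfy the coupled
    recurrence [E (m+1) = x * O m - E m], [O (m+1) = E (m+1) - O m]. Each of the
    two geometric families on the right-hand sides solves it, because [lambda]
    and [kappa] are roots of [t^2 - (x - 2) t + 1]; the initial values then
    determine the solution. *)

Lemma sgibonacci_at0 (R : realType) (alpha beta : R) (x : R[i]) :
  sgibonacci_at alpha beta 0 x = alpha%:C.
Proof. by rewrite /sgibonacci_at /= map_polyC hornerC. Qed.

Lemma sgibonacci_at1 (R : realType) (alpha beta : R) (x : R[i]) :
  sgibonacci_at alpha beta 1 x = beta%:C.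
Proof. by rewrite /sgibonacci_at /= map_polyC hornerC. Qed.

Lemma sgibonacci_atSS (R : realType) (alpha beta : R) (k : nat) (x : R[i]) :
  sgibonacci_at alpha beta k.+2 x =
  x ^+ (k.+1 %% 2) * sgibonacci_at alpha beta k.+1 x
    - sgibonacci_at alpha beta k x.
Proof.
rewrite /sgibonacci_at -[sgibonacci _ _ k.+2]/('X^(k.+1 %% 2) *
  sgibonacci alpha beta k.+1 - sgibonacci alpha beta k).
by rewrite rmorphB rmorphM /= map_polyXn hornerD hornerN hornerM hornerXn.
Qed.

(** Only the sum and product of [l] and [k] enter, so the choice of square root is irrelevant. *)
Lemma coupled_recurrence_binet (F : fieldType) (a b x l k : F) (E O : nat -> F) :
    l * k = 1 -> l + k = x - 2%:R -> k - l != 0 ->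
    E 0%N = a -> O 0%N = b ->
    (forall m, E m.+1 = x * O m - E m) ->
    (forall m, O m.+1 = E m.+1 - O m) ->
  forall m,
    E m = (l ^+ m * ((k + 1) * a - x * b) - k ^+ m * ((l + 1) * a - x * b))
          / (k - l) /\
    O m = (l ^+ m * (a - (l + 1) * b) - k ^+ m * (a - (k + 1) * b)) / (k - l).
Proof.
move=> lk lDk kl0 E0 O0 ES OS.
have xE : x = l + k + 2%:R by rewrite lDk subrK.
elim=> [|m [IHE IHO]].
  by rewrite E0 O0 !expr0; split; field.
have ESm : E m.+1 = (l ^+ m.+1 * ((k + 1) * a - x * b)
    - k ^+ m.+1 * ((l + 1) * a - x * b)) / (k - l).
  rewrite ES IHE IHO !exprS mulrA -mulrBl; congr (_ / _).
  (* Modulo [l * k = 1], one has [l * (k + 1) = l + 1] and [x = (l + 1) * (k + 1)], so each family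
     is multiplied by its own root. *)
  by rewrite xE; ring: lk.
split=> //; rewrite OS ESm IHO -mulrBl !exprS; congr (_ / _).
(* Here the key relations are [l * x = (l + 1) ^+ 2] and its analogue for [k]. *)
by rewrite xE; ring: lk.
Qed.

Theorem theorem3p1 (R : realType) (alpha beta : R) (x s : R[i])
    (alpha_gt0 : 0 < alpha) (beta_gt0 : 0 < beta)
    (disc_neq0 : x ^+ 2 - 4%:R * x <> 0)
    (s_sqrt : s ^+ 2 = x ^+ 2 - 4%:R * x) (m : nat) :
  let lambda := 2%:R^-1 * (x - 2%:R + s) in
  let kappa := 2%:R^-1 * (x - 2%:R - s) in
  sgibonacci_at alpha beta (2 * m) x =
    (lambda ^+ m * ((kappa + 1) * alpha%:C - x * beta%:C)
      - kappa ^+ m * ((lambda + 1) * alpha%:C - x * beta%:C))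
    / (kappa - lambda)
  /\
  sgibonacci_at alpha beta (2 * m + 1) x =
    (lambda ^+ m * (alpha%:C - (lambda + 1) * beta%:C)
      - kappa ^+ m * (alpha%:C - (kappa + 1) * beta%:C))
    / (kappa - lambda).
Proof.
move=> lambda kappa.
have lk : lambda * kappa = 1.
  have -> : lambda * kappa = 4%:R^-1 * ((x - 2%:R) ^+ 2 - s ^+ 2).
    by rewrite /lambda /kappa; field.
  (* [(x - 2) ^+ 2] exceeds the discriminant by exactly 4. *)
  by rewrite s_sqrt; field.
have lDk : lambda + kappa = x - 2%:R by rewrite /lambda /kappa; field.
have kl0 : kappa - lambda != 0.
  have -> : kappa - lambda = - s by rewrite /lambda /kappa; field.
  rewrite oppr_eq0; apply/eqP => s0; apply: disc_neq0.
  by rewrite -s_sqrt s0 expr0n.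
apply: (@coupled_recurrence_binet _ alpha%:C beta%:C x lambda kappa
  (fun n => sgibonacci_at alpha beta (2 * n) x)
  (fun n => sgibonacci_at alpha beta (2 * n + 1) x)) => //.
- by rewrite muln0 sgibonacci_at0.
- by rewrite muln0 sgibonacci_at1.
(* At index [2n + 2] the exponent [(2n + 1) %% 2] is 1, which gives the factor [x]. *)
- by move=> n; rewrite mulnS !add2n addn1 sgibonacci_atSS -addn1 mulnC modnMDl expr1.
(* At index [2n + 3] the exponent is 0 and the factor disappears. *)
- move=> n; rewrite mulnS add2n !addn1 sgibonacci_atSS.
  by rewrite -addn2 mulnC -mulSnr modnMl expr0 mul1r.
Qed.
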